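(* Let $p<q<r$ be odd primes and let $\Psi_{pqr}(x)=\prod_{1\le j\le pqr,\ \gcd(j,pqr)>1}(x-\zeta_{pqr}^j)$, where $\zeta_{pqr}$ is a primitive $pqr$-th root of unity. Then $h(\Psi_{pqr}(x))=p-1$ if and only if $$\text{either } q\equiv r\equiv 1 \pmod p \text{ or } q\equiv r\equiv -1\pmod p,\quad\text{and}\quad r<\frac{(p-1)}{(p-2)}(q-1).$$ In all remaining cases $h(\Psi_{pqr}(x))<p-1$.
   Context: For a polynomial $f\in\mathbb Z[x]$, the height $h(f)$ is the maximum of the absolute values of its coefficients. Equivalently $\Psi_n(x)=(x^n-1)/\Phi_n(x)$, where $\Phi_n$ is the $n$-th cyclotomic polynomial; $\Psi_n$ has integer coefficients. *)

(* Defs.v *)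
From HB Require Import structures.
From mathcomp Require Export all_boot all_order all_algebra all_field.

Set Implicit Arguments.
Unset Strict Implicit.
Unset Printing Implicit Defensive.

Import Order.TTheory GRing.Theory Num.Theory.
Local Open Scope ring_scope.

(* The maximum over the empty range is 0, so that height 0 = 0. *)
Definition height (f : {poly int}) : nat := (\max_(i < size f) `|(f`_i)%R|)%N.

Definition inv_cyclotomic (R : nzRingType) (z : R) (n : nat) : {poly R} :=
  \prod_(1 <= j < n.+1 | (1 < gcdn j n)%N) ('X - (z ^+ j)%:P).

(* Descent to int, exactly as in the library definition of 'Phi_n; the lemma
   Cintr_InvCyclotomic shows that taking floors loses nothing and that the
   choice of the primitive root of unity does not matter. *)
Definition InvCyclotomic (n : nat) : {poly int} :=
  let: exist z _ := C_prim_root_exists (ltn0Sn n.-1) in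
  map_poly Num.floor (inv_cyclotomic z n).

Notation "''Psi_' n" := (InvCyclotomic n)
  (at level 8, n at level 2, format "''Psi_' n").

Lemma inv_cyclotomicM (F : fieldType) (n : nat) (z : F) :
  n.-primitive_root z -> inv_cyclotomic z n * cyclotomic z n = 'X^n - 1.
Proof.
move=> prim_z; have n_gt0 := prim_order_gt0 prim_z.
have -> : cyclotomic z n =
    \prod_(1 <= j < n.+1 | ~~ (1 < gcdn j n)%N) ('X - (z ^+ j)%:P).
  rewrite /cyclotomic -(big_mkord (coprime^~ n) (fun k => 'X - (z ^+ k)%:P)).
  rewrite big_mkcond [RHS]big_mkcond /= big_ltn // [RHS]big_nat_recr //=.
  rewrite mulrC; congr (_ * _); last first.
    by rewrite /coprime gcd0n gcdnn (prim_expr_order prim_z) expr0 -leqNgt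
               eqn_leq n_gt0 andbT.
  apply: eq_bigr => j _; rewrite /coprime -leqNgt eqn_leq.
  by rewrite gcdn_gt0 n_gt0 orbT andbT.
rewrite -(factor_Xn_sub_1 prim_z) [RHS]big_ltn // expr0 [RHS]mulrC.
have <- : \prod_(1 <= j < n.+1) ('X - (z ^+ j)%:P) =
          \prod_(1 <= j < n) ('X - (z ^+ j)%:P) * ('X - 1%:P).
  by rewrite big_nat_recr //= (prim_expr_order prim_z).
by rewrite [RHS](bigID (fun j => 1 < gcdn j n)%N).
Qed.

Lemma Cintr_InvCyclotomic (n : nat) (z : algC) :
  n.-primitive_root z -> map_poly intr 'Psi_n = inv_cyclotomic z n.
Proof.
move=> prim_z; have n_gt0 := prim_order_gt0 prim_z.
pose Q : {poly int} := \prod_(d <- rem n (divisors n)) 'Phi_d.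
have defQ (y : algC) : n.-primitive_root y -> inv_cyclotomic y n = map_poly intr Q.
  move=> prim_y; have nzPhi : cyclotomic y n != 0.
    exact/monic_neq0/cyclotomic_monic.
  apply: (mulIf nzPhi); rewrite inv_cyclotomicM //.
  rewrite -(Cintr_Cyclotomic prim_y) -rmorphM /= mulrC.
  have n_div : n \in divisors n by rewrite -dvdn_divisors.
  rewrite -(big_rem n n_div (P := xpredT) (F := Cyclotomic)) /=.
  by rewrite prod_Cyclotomic // rmorphB rmorph1 /= map_polyXn.
rewrite /InvCyclotomic; case: (C_prim_root_exists _) => y /=.
rewrite prednK // => prim_y; rewrite (defQ z) // (defQ y) //.
by rewrite floorpK //; apply/polyOverP=> i; rewrite coef_map /= rpred_int.
Qed.

Lemma InvCyclotomicM (n : nat) : (0 < n)%N -> 'Psi_n * 'Phi_n = 'X^n - 1.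
Proof.
move=> n_gt0; have [z prim_z] := C_prim_root_exists n_gt0.
apply: (map_inj_poly (intr_inj : injective (intr : int -> algC))) => //.
rewrite rmorphM /= (Cintr_InvCyclotomic prim_z) (Cintr_Cyclotomic prim_z).
by rewrite inv_cyclotomicM // rmorphB rmorph1 /= map_polyXn.
Qed.

(* Main.v *)
(** The identity Psi_pqr(x) = Phi_pq(x) (x^(qr) - 1) (1 + x^r + ... + x^((p-1)r))
    makes each coefficient of Psi_pqr a signed sum of coefficients of Phi_pq along
    a progression of difference r.  Since deg Phi_pq = (p-1)(q-1) < (p-1)r, at most
    p - 1 terms are nonzero, and all are at most 1 in absolute value; the terms
    coming from x^(qr) and from -1 have opposite signs but are separated by a gap,
    as p < q.  So the height is at most p - 1, with equality iff Phi_pq is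
    constantly 1 or constantly -1 on some n, n + r, ..., n + (p-2)r.  The degree
    gives (p-2)r < (p-1)(q-1).  Write m = jq (mod p) with 0 <= j < p and let c be the
    inverse of q mod p: a coefficient 1 at m forces j < c, a coefficient -1 forces
    j >= c.  A progression of length p - 1 meets p - 1 different j, so c = p - 1 or
    c = 1, that is q = -1 or q = 1 (mod p); then the m with a given j lie in
    consecutive intervals of length q, so j grows by 1 at each step and r = q (mod p).
    Conversely the progressions starting at 0, respectively 1, work. *)

Require Import Defs.
From mathcomp Require Import zify ring.

Set Implicit Arguments.
Unset Strict Implicit.
Unset Printing Implicit Defensive.

Import Order.TTheory GRing.Theory Num.Theory.
Local Open Scope ring_scope.

(** * Factorisation of ['Psi_(p * q * r)] through ['Phi_(p * q)] *)

Lemma divisors_mul_prime (n r : nat) : (0 < n)%N -> prime r -> ~~ (r %| n)%N ->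
  perm_eq (divisors (n * r)) (divisors n ++ [seq (d * r)%N | d <- divisors n]).
Proof.
move=> n_gt0 r_pr rNn; have r_gt0 := prime_gt0 r_pr.
have inj_r : injective (muln^~ r) by move=> d e /eqP; rewrite eqn_pmul2r // => /eqP.
apply: uniq_perm; first exact: divisors_uniq.
  rewrite cat_uniq (map_inj_uniq inj_r) !divisors_uniq andbT /=.
  apply/hasPn => _ /mapP[d _ ->]; rewrite -dvdn_divisors //.
  by apply: contra rNn; apply: dvdn_trans; rewrite dvdn_mull.
move=> d; rewrite mem_cat -!dvdn_divisors ?muln_gt0 ?n_gt0 //.
have [/dvdnP[e ->] | rNd] := boolP (r %| d)%N.
  rewrite dvdn_pmul2r // (mem_map inj_r) -dvdn_divisors //.
  by rewrite orb_idl //; apply: dvdn_trans; rewrite dvdn_mulr.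
rewrite Gauss_dvdl; last by rewrite coprime_sym prime_coprime.
by rewrite orb_idr // => /mapP[e _ def_d]; rewrite def_d dvdn_mull in rNd.
Qed.

Lemma prod_Cyclotomic_mul_prime (n r : nat) :
    (0 < n)%N -> prime r -> ~~ (r %| n)%N ->
  'X^(n * r) - 1 = ('X^n - 1) * \prod_(d <- divisors n) 'Phi_(d * r).
Proof.
move=> n_gt0 r_pr rNn; rewrite -prod_Cyclotomic ?muln_gt0 ?n_gt0 ?prime_gt0 //.
rewrite (perm_big _ (divisors_mul_prime n_gt0 r_pr rNn)) big_cat big_map /=.
by rewrite prod_Cyclotomic.
Qed.

Lemma divisors_prime (p : nat) : prime p -> perm_eq (divisors p) [:: 1%N; p].
Proof.
move=> p_pr; have := divisors_mul_prime (ltn0Sn 0) p_pr.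
by rewrite !mul1n /= mul1n; apply; rewrite Euclid_dvd1.
Qed.

Lemma monic_Xn_sub_1_neq0 (R : nzRingType) (n : nat) :
  (0 < n)%N -> 'X^n - 1 != 0 :> {poly R}.
Proof. by move=> n_gt0; apply/monic_neq0/monic_Xn_sub_1. Qed.

Lemma Xn_sub_1_prime (p : nat) : prime p -> 'X^p - 1 = ('X - 1) * 'Phi_p.
Proof.
move=> p_pr; have := prod_Cyclotomic_mul_prime (ltn0Sn 0) p_pr.
by rewrite Euclid_dvd1 // mul1n => ->; rewrite // big_seq1 mul1n.
Qed.

Lemma Xn_sub_1_prime2 (p q : nat) : prime p -> prime q -> p != q ->
  'X^(p * q) - 1 = ('X^p - 1) * ('Phi_q * 'Phi_(p * q)).
Proof.
move=> p_pr q_pr neq_pq.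
rewrite (prod_Cyclotomic_mul_prime (prime_gt0 p_pr) q_pr); last first.
  by rewrite dvdn_prime2 // eq_sym.
by rewrite (perm_big _ (divisors_prime p_pr)) big_cons big_seq1 mul1n.
Qed.

Lemma Cyclotomic_prime2 (p q : nat) : prime p -> prime q -> p != q ->
  'Phi_(p * q) * (('X^p - 1) * ('X^q - 1)) = ('X^(p * q) - 1) * ('X - 1).
Proof.
by move=> *; rewrite Xn_sub_1_prime2 // (@Xn_sub_1_prime q) //; ring.
Qed.

(** After multiplication by ['Phi_(p * q * r)], both sides reduce to ['X^(p * q) - 1], ['X - 1] and
    the cyclotomic polynomials of index [d * r] with [d] dividing [p * q], where ['Phi_r] occurs
    twice. *)
Lemma InvCyclotomic_prime3 (p q r : nat) :
    prime p -> prime q -> prime r -> p != q -> p != r -> q != r ->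
  'Psi_(p * q * r) * ('X^r - 1) = 'Phi_(p * q) * (('X^(q * r) - 1) * ('X^(p * r) - 1)).
Proof.
move=> p_pr q_pr r_pr neq_pq neq_pr neq_qr.
have pqr_gt0 : (0 < p * q * r)%N by rewrite !muln_gt0 !prime_gt0.
have Phi_neq0 : 'Phi_(p * q * r) != 0 by apply/monic_neq0/Cyclotomic_monic.
apply: (mulIf Phi_neq0); rewrite mulrAC InvCyclotomicM //.
have rNpq : ~~ (r %| p * q)%N.
  by rewrite Euclid_dvdM // !dvdn_prime2 // negb_or ![r == _]eq_sym neq_pr.
have qNp : ~~ (q %| p)%N by rewrite dvdn_prime2 // eq_sym.
have pq_gt0 : (0 < p * q)%N by rewrite muln_gt0 !prime_gt0.
rewrite (prod_Cyclotomic_mul_prime pq_gt0 r_pr rNpq).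
rewrite (perm_big _ (divisors_mul_prime (prime_gt0 p_pr) q_pr qNp)) big_cat big_map /=.
rewrite !(perm_big _ (divisors_prime p_pr)) !big_cons !big_nil !mul1n /= !mulr1.
rewrite (Xn_sub_1_prime2 p_pr r_pr neq_pr) (Xn_sub_1_prime2 q_pr r_pr neq_qr).
rewrite (Xn_sub_1_prime r_pr).
transitivity (('X^(p * q) - 1) * ('X - 1) * ('Phi_r * ('Phi_r * 'Phi_(p * r) *
  'Phi_(q * r) * 'Phi_(p * q * r)))); first by ring.
by rewrite -Cyclotomic_prime2 //; ring.
Qed.

Lemma subrX1_mul (R : comPzRingType) (x : R) (m n : nat) :
  x ^+ (m * n) - 1 = (x ^+ n - 1) * \sum_(i < m) x ^+ (i * n).
Proof.
rewrite mulnC exprM subrX1; congr (_ * _).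
by apply: eq_bigr => i _; rewrite -exprM mulnC.
Qed.

Lemma Cyclotomic_prime2_sum (p q : nat) : prime p -> prime q -> p != q ->
  'Phi_(p * q) * ('X^p - 1) = ('X - 1) * \sum_(j < p) 'X^(j * q).
Proof.
move=> p_pr q_pr neq_pq; apply: (mulIf (monic_Xn_sub_1_neq0 _ (prime_gt0 q_pr))).
by rewrite -mulrA Cyclotomic_prime2 // subrX1_mul; ring.
Qed.

(** For [p < q] its coefficients are -1 on [0, p), 1 on [q, q + p) and 0 elsewhere. Substituting
    ['X^r] gives the cofactor of ['Phi_(p * q)]. *)
Definition sign_poly (p q : nat) : {poly int} := ('X^q - 1) * \sum_(j < p) 'X^j.

Lemma InvCyclotomic_prime3_comp (p q r : nat) :
    prime p -> prime q -> prime r -> p != q -> p != r -> q != r ->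
  'Psi_(p * q * r) = 'Phi_(p * q) * (sign_poly p q \Po 'X^r).
Proof.
move=> p_pr q_pr r_pr neq_pq neq_pr neq_qr.
apply: (mulIf (monic_Xn_sub_1_neq0 _ (prime_gt0 r_pr))).
rewrite InvCyclotomic_prime3 // (subrX1_mul _ p r) -mulrA; congr (_ * _).
rewrite /sign_poly comp_polyM comp_polyB comp_Xn_poly comp_polyC -exprM mulnC.
rewrite [_ * ('X^r - 1)]mulrAC [RHS]mulrAC -!mulrA; congr (_ * _).
rewrite [RHS]mulrC; congr (_ * _); rewrite rmorph_sum /=.
by apply: eq_bigr => j _; rewrite comp_Xn_poly -exprM mulnC.
Qed.

(** * Coefficients of a product with a polynomial in ['X^r] *)

Lemma coef_sum_Xn (R : nzSemiRingType) (n i : nat) :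
  (\sum_(j < n) 'X^j : {poly R})`_i = (i < n)%:R.
Proof.
rewrite coef_sum; under eq_bigr do rewrite coefXn.
case: ltnP => [lt_in | le_ni].
  rewrite (bigD1 (Ordinal lt_in)) //= eqxx big1 ?addr0 // => j.
  by rewrite -val_eqE /= eq_sym => /negPf->.
by rewrite big1 // => j _; case: eqP => // def_i; rewrite def_i leqNgt ltn_ord in le_ni.
Qed.

Lemma coef_sign_poly (p q i : nat) :
  (sign_poly p q)`_i = (q <= i < q + p)%N%:R - (i < p)%N%:R.
Proof.
rewrite /sign_poly mulrBl mul1r coefB coefXnM !coef_sum_Xn; congr (_ - _).
by case: leqP => //= le_qi; rewrite ltn_subLR.
Qed.

(** Horner induction on [P]: a factor ['X] in [P] lowers [n] by one and keeps the residue [t]. *)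
Lemma coef_mul_comp_Xn (R : comNzRingType) (A P : {poly R}) (r t n : nat) :
    (t < r)%N ->
  (A * (P \Po 'X^r))`_(t + n * r) = \sum_(i < n.+1) P`_i * A`_(t + (n - i) * r).
Proof.
move=> lt_tr; elim/poly_ind: P n => [|P c IH] n.
  by rewrite comp_poly0 mulr0 coef0 big1 // => i _; rewrite coef0 mul0r.
rewrite comp_poly_MXaddC mulrDr mulrA coefD coefMXn coefMC [RHS]big_ord_recl subn0.
rewrite coefD coefMX coefC /= add0r addrC [_ * c]mulrC; congr (_ + _).
case: n => [|n]; first by rewrite mul0n addn0 lt_tr big_ord0.
rewrite mulSn addnCA ltnNge leq_addr /= addKn IH; apply: eq_bigr => i _.
by rewrite coefD coefMX coefC addr0 subSS.
Qed.

(** Indexed by the position [s] in [A], the sum gets a length independent of [n], since [A] vanishes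
    from [d * r] on. The test [s <= n] guards the truncated [n - s]. *)
Lemma coef_mul_comp_Xn_trunc (R : comNzRingType) (A P : {poly R}) (r t n d : nat) :
    (t < r)%N -> (size A <= d * r)%N ->
  (A * (P \Po 'X^r))`_(t + n * r) =
    \sum_(s < d) (if (s <= n)%N then P`_(n - s) else 0) * A`_(t + s * r).
Proof.
move=> lt_tr le_Ad; rewrite coef_mul_comp_Xn // (reindex_inj rev_ord_inj) /=.
pose G s := (if (s <= n)%N then P`_(n - s) else 0) * A`_(t + s * r).
transitivity (\sum_(s < n.+1) G s).
  by apply: eq_bigr => i _; rewrite /G subSS -ltnS ltn_ord subKn // -ltnS.
rewrite (big_ord_widen (maxn n.+1 d) G) ?leq_maxl //.
rewrite [RHS](big_ord_widen (maxn n.+1 d) G) ?leq_maxr //.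
rewrite big_mkcond [RHS]big_mkcond; apply: eq_bigr => s _ /=.
rewrite ltnS /G; case: (leqP s n) => [le_sn | _]; last by rewrite mul0r if_same.
case: ifP => // /negbT; rewrite -leqNgt => le_ds.
rewrite [A`__]nth_default ?mulr0 //.
apply: leq_trans le_Ad (leq_trans (leq_mul le_ds (leqnn r)) _).
exact: leq_addl.
Qed.

(** * Extremal sums and bounds on the height *)

Lemma sum_norm_le1_extremal (n : nat) (x : 'I_n -> int) :
    (forall i, `|x i| <= 1) -> `|\sum_i x i| = n%:Z ->
  exists2 e : int, `|e| = 1 & forall i, x i = e.
Proof.
move=> x_le1 norm_sum.
have sum1 (e : int) : \sum_(i < n) e = e * n%:Z.
  by rewrite sumr_const card_ord -mulr_natr natz.
have [e norm_e sum_e] : exists2 e : int, `|e| = 1 & \sum_i x i = e * n%:Z.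
  by case: (ger0P (\sum_i x i)) norm_sum => _ def_n; [exists 1 | exists (-1)];
    rewrite ?mulN1r -?def_n; lia.
exists e => // i.
(* With [e] the sign of the sum, these terms are nonnegative, so each of them vanishes. *)
have sum0 : \sum_i (1 - e * x i) = 0.
  rewrite big_split /= sumrN -mulr_sumr sum_e sum1; lia.
have /(_ i isT) : forall i, true -> 1 - e * x i = 0.
  apply: psumr_eq0P sum0 => j _; have := x_le1 j; lia.
by lia.
Qed.

Lemma height_leP (f : {poly int}) (n : nat) :
  reflect (forall k, (`|(f`_k)%R| <= n)%N) (height f <= n)%N.
Proof.
apply: (iffP (bigmax_leqP _ _ _)) => [f_le k | f_le i _]; last exact: f_le.
have [lt_kf | le_fk] := ltnP k (size f); last by rewrite nth_default.
exact: (f_le (Ordinal lt_kf)).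
Qed.

(** When [c] is the inverse of [q] mod [p], this is the [j < p] with [j * q = m %[mod p]]. *)
Definition mod_quot (p c m : nat) : nat := (c * m) %% p.

(** * Coefficients of ['Phi_(p * q)] *)

Section CoefPhi.

Variables p q c : nat.
Hypothesis cq1 : (c * q = 1 %[mod p])%N.
Local Notation J := (mod_quot p c).

Lemma mod_quotK m : (J m * q = m %[mod p])%N.
Proof. by rewrite modnMml mulnAC -modnMml cq1 modnMml mul1n. Qed.

Lemma mod_quot_uniq j m : (j < p)%N -> (j * q = m %[mod p])%N -> J m = j.
Proof.
move=> lt_jp def_m; rewrite /mod_quot -modnMmr -def_m modnMmr mulnCA.
by rewrite -modnMmr cq1 modnMmr muln1 modn_small.
Qed.

Lemma mod_quotD m : J (m + p) = J m.
Proof. by rewrite /mod_quot mulnDr addnC modnMDl. Qed.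

(** The step by [c] without wrapping is the source of the coefficients -1, the step with wrapping
    that of the coefficients 1. *)
Lemma mod_quotS m : (0 < p)%N -> (c < p)%N ->
  J m.+1 = if (J m + c < p)%N then (J m + c)%N else (J m + c - p)%N.
Proof.
move=> p_gt0 lt_cp; rewrite /mod_quot mulnS addnC -modnDml -/(J m).
have lt_J : (J m < p)%N by rewrite ltn_mod.
case: ltnP => [/modn_small // | le_p]; rewrite -{1}(subnK le_p) modnDr modn_small //.
by lia.
Qed.

(** The inequality [J m * q <= m] says that [m] lies in the numerical semigroup generated by [p] and
    [q]; the coefficient compares [m] with its predecessor. *)
Lemma coef_Cyclotomic_prime2 m : prime p -> prime q -> p != q ->
  ('Phi_(p * q))`_m = (J m * q <= m)%N%:R - ((0 < m) && (J m.-1 * q <= m.-1))%N%:R.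
Proof.
move=> p_pr q_pr neq_pq; have p_gt0 := prime_gt0 p_pr.
(* Phi_pq (1 - x^p) = (1 - x) U for U = 1 + x^q + ... + x^((p-1)q), and dividing U
   by 1 - x^p turns its coefficients [u] into their sums [T] along steps of p. *)
pose T m := (J m * q <= m)%N%:R : int.
pose u m := (J m * q == m)%N%:R : int.
have T_rec n : T n = u n + (if (n < p)%N then 0 else T (n - p)%N).
  rewrite /T /u; case: ltnP => [lt_np | le_pn].
    rewrite addr0; congr (nat_of_bool _)%:R; apply/idP/eqP => [|-> //].
    move=> le_n; have := mod_quotK n; rewrite [RHS]modn_small // modn_small //.
    exact: leq_ltn_trans le_n lt_np.
  have [d ->] : exists d, n = (d + p)%N by exists (n - p)%N; rewrite subnK.
  rewrite mod_quotD addnK; have [le_d | lt_d] := leqP (J d * q) d.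
    by rewrite ltn_eqF ?add0r ?(leq_trans le_d) ?leq_addr // -addn1 leq_add.
  (* Here [J d * q - d] is a positive multiple of [p], so [J d * q] is at least [d + p]. *)
  have /eqP := mod_quotK d; rewrite eqn_mod_dvd ?(ltnW lt_d) // => /dvdnP[k def_k].
  rewrite addr0; congr (nat_of_bool _)%:R; rewrite eqn_leq andb_idr // => _.
  by case: k def_k => [|k]; nia.
have coef_u n : (\sum_(j < p) 'X^(j * q) : {poly int})`_n = u n.
  rewrite coef_sum /u; under eq_bigr do rewrite coefXn.
  have [def_n | neq_n] := eqVneq (J n * q)%N n.
    have lt_J : (J n < p)%N by rewrite ltn_mod.
    rewrite (bigD1 (Ordinal lt_J)) //= def_n eqxx big1 ?addr0 // => j.
    rewrite -val_eqE /= -{2}def_n eqn_pmul2r ?prime_gt0 // eq_sym.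
    by move=> /negPf->.
  rewrite big1 // => j _; case: eqP => // def_n.
  by rewrite {1}def_n (@mod_quot_uniq j) -?def_n ?eqxx in neq_n.
have Phi_rec n : ('Phi_(p * q))`_n =
    (if (n < p)%N then 0 else ('Phi_(p * q))`_(n - p)) + u n
      - (if (n == 0)%N then 0 else u n.-1).
  have aux (a b x y : int) : a - x = b - y -> x = a + y - b by lia.
  have := congr1 (fun f : {poly int} => f`_n) (Cyclotomic_prime2_sum p_pr q_pr neq_pq).
  rewrite /= mulrBr mulrBl mulr1 mul1r !coefB coefMXn coefXM !coef_u; exact: aux.
have -> : ((0 < m) && (J m.-1 * q <= m.-1))%N%:R = (if m == 0%N then 0 else T m.-1).
  by case: (m).
elim/ltn_ind: m => m IH; rewrite Phi_rec -/(T m) T_rec.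
case: m IH => [|m] IH /=; first by rewrite p_gt0; lia.
rewrite (T_rec m); have [lt_mp | le_pm] := ltnP m.+1 p; first by rewrite (ltnW lt_mp) /=; lia.
rewrite IH; last by lia.
rewrite -/(T _) subn_eq0; have [lt_mp | le_pm'] := ltnP m p.
  by lia.
have -> : (m.+1 - p).-1 = (m - p)%N by lia.
by lia.
Qed.

Section Signs.

Hypotheses (p_pr : prime p) (q_pr : prime q) (neq_pq : p != q) (lt_cp : (c < p)%N).

Let p_gt0 : (0 < p)%N. Proof. exact: prime_gt0. Qed.

Lemma mod_inv_gt0 : (0 < c)%N.
Proof.
by rewrite lt0n; apply/eqP => c0; move: cq1; rewrite c0 mod0n modn_small ?prime_gt1.
Qed.

Lemma norm_coef_Cyclotomic_prime2 m : `|('Phi_(p * q))`_m| <= 1.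
Proof. by rewrite coef_Cyclotomic_prime2 //; case: (_ <= _)%N; case: (_ && _). Qed.

(** For [m > 0], the inequality holds at [m] and fails at [m.-1], so [J] has wrapped:
    [J m = J m.-1 + c - p]. Hence [J m < c], and the failure at [m.-1] is the upper bound. *)
Lemma coef_Cyclotomic_prime2_eq1 m : ('Phi_(p * q))`_m = 1 ->
  (J m < c)%N /\ (J m * q <= m <= (J m + (p - c)) * q)%N.
Proof.
rewrite coef_Cyclotomic_prime2 //; case: m => [|m] /=.
  by rewrite /mod_quot muln0 mod0n mul0n mod_inv_gt0.
have lt_J : (J m < p)%N by rewrite ltn_mod.
rewrite mod_quotS //; case: (leqP (J m * q) m); first by case: (_ <= m.+1)%N.
have q_gt0 := prime_gt0 q_pr; have c_gt0 := mod_inv_gt0.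
case: (leqP _ m.+1) => //; case: ltnP => [_ | le_p] le_m lt_m _; first by nia.
have -> : (J m + c - p + (p - c) = J m)%N by lia.
by split; lia.
Qed.

(** Now the inequality holds at [m.-1] and fails at [m], so [J] has grown without wrapping and
    [J m.-1 = J m - c]. *)
Lemma coef_Cyclotomic_prime2_eqN1 m : ('Phi_(p * q))`_m = -1 ->
  [/\ (c <= J m)%N, (J m < p)%N & ((J m - c) * q < m < J m * q)%N].
Proof.
rewrite coef_Cyclotomic_prime2 //; case: m => [|m] /=; first by case: (_ <= _)%N.
have lt_J : (J m < p)%N by rewrite ltn_mod.
have q_gt0 := prime_gt0 q_pr; have c_gt0 := mod_inv_gt0.
rewrite mod_quotS //; case: (ltnP (J m + c)%N p) => [lt_p | le_p].
  case: (leqP _ m.+1) => [_ | lt_m]; first by case: (_ <= m)%N.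
  case: (leqP _ m) => // le_m _; rewrite addnK ltnS le_m andbT.
  by split=> //; rewrite leq_addl.
case: (leqP _ m.+1) => [_ | lt_m]; first by case: (_ <= m)%N.
by case: (leqP _ m) => // le_m _; nia.
Qed.

End Signs.

End CoefPhi.

(** * Progressions on which ['Phi_(p * q)] is constantly 1 or -1 *)

(** Serves both signs: [K] and [d] are [J] and [c] for coefficient 1, [J - c] and [p - c] for
    coefficient -1. *)
Lemma progression_blocks (p q r n d : nat) (K : nat -> nat) :
    (2 < p)%N -> (0 < r)%N -> (d < p)%N ->
    (forall s, (s < p - 1)%N ->
       (K s < d)%N /\ (K s * q <= n + s * r <= (K s + (p - d)) * q)%N) ->
    (forall s t, (s < p - 1)%N -> (t < p - 1)%N -> K s = K t -> s = t) ->
  [/\ d = (p - 1)%N, K 0%N = 0%N & K 1%N = 1%N].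
Proof.
move=> p_gt2 r_gt0 lt_dp K_bound K_inj.
have lt_Kd (s : 'I_(p - 1)) : (K s < d)%N by have [] := K_bound s (ltn_ord s).
have def_d : d = (p - 1)%N.
  (* Pigeonhole: [K] takes [p - 1] distinct values below [d]. *)
  suff : (p - 1 <= d)%N by lia.
  rewrite -(card_ord (p - 1)) -(card_ord d).
  apply: (@leq_card _ _ (fun s => Ordinal (lt_Kd s))) => s t /(congr1 val) /= eqK.
  by apply: val_inj; apply: K_inj eqK.
(* The intervals now have length [q], so [K] cannot decrease along the progression, and injectivity
   makes the growth strict. *)
have K_incr s : (s.+1 < p - 1)%N -> (K s < K s.+1)%N.
  move=> lt_s; have [_ /andP[lo _]] := K_bound s (ltnW lt_s).
  have [_ /andP[_ hi]] := K_bound s.+1 lt_s.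
  rewrite def_d in hi; have pd1 : (p - (p - 1) = 1)%N by lia.
  rewrite pd1 in hi; have leK : (K s <= K s.+1)%N by nia.
  rewrite ltn_neqAle leK andbT; apply/eqP => /(K_inj _ _ (ltnW lt_s) lt_s); lia.
have K_ge s : (s.+1 < p - 1)%N -> (K 1%N + s <= K s.+1)%N.
  elim: s => [|s IH] lt_s; first by rewrite addn0.
  by rewrite addnS (leq_trans _ (K_incr _ lt_s)) // ltnS IH // ltnW.
have lt1 : (1 < p - 1)%N by lia.
(* At the last index, strict growth against the bound [d] forces [K 1 <= 1]. *)
have lt_p3 : ((p - 3).+1 < p - 1)%N by lia.
have [lt_d _] := K_bound _ lt_p3; have := K_ge _ lt_p3; have := K_incr _ lt1.
by split; lia.
Qed.

Lemma mod_inverse (p q : nat) : prime p -> coprime p q ->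
  exists2 c, (c < p)%N & (c * q = 1 %[mod p])%N.
Proof.
move=> p_pr co_pq; have [a lt_ap] := Bezoutl q (prime_gt0 p_pr).
(* Bezout gives [p %| 1 + a * q], so [- a] inverts [q]; [a] is nonzero since [p] does not divide
   1. *)
rewrite (eqP co_pq) => dv; exists (p - a)%N.
  by case: a lt_ap dv => [|a]; rewrite ?Euclid_dvd1 //; lia.
apply/eqP; rewrite -(eqn_modDr (a * q)) -mulnDl subnK ?(ltnW lt_ap) //.
by rewrite modnMr; move: dv; rewrite /dvdn eq_sym.
Qed.

(** The condition of the theorem in natural numbers: divisibility replaces the residue -1, and the
    denominator [p - 2] is cleared. *)
Definition extremal_nat (p q r : nat) : Prop :=
  ((q = 1 %[mod p])%N /\ (r = 1 %[mod p])%N \/ (p %| q + 1)%N /\ (p %| r + 1)%N) /\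
  ((p - 2) * r < (p - 1) * (q - 1))%N.

Lemma mod_quot_progression_inj (p q c r n s t : nat) : prime p -> ~~ (p %| r)%N ->
    (c * q = 1 %[mod p])%N -> (s < p)%N -> (t < p)%N ->
  mod_quot p c (n + s * r) = mod_quot p c (n + t * r) -> s = t.
Proof.
move=> p_pr pNr cq1.
wlog le_st : s t / (s <= t)%N => [IH | lt_s lt_t eqJ].
  by case: (leqP s t) => [/IH // | /ltnW/IH H] *; apply/esym/H.
have := mod_quotK cq1 (n + t * r); rewrite -eqJ (mod_quotK cq1) => /esym/eqP.
rewrite eqn_modDl eqn_mod_dvd ?leq_mul // -mulnBl Euclid_dvdM // (negPf pNr) orbF.
by move/dvdn_leq; lia.
Qed.

Lemma coef_Cyclotomic_prime2_progression (p q r n : nat) (e : int) :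
    prime p -> prime q -> prime r -> (2 < p)%N -> (p < q)%N -> (q < r)%N ->
    `|e| = 1 -> (forall s, (s < p - 1)%N -> ('Phi_(p * q))`_(n + s * r) = e) ->
  extremal_nat p q r.
Proof.
move=> p_pr q_pr r_pr p_gt2 lt_pq lt_qr norm_e Phi_e.
have neq_pq : p != q by rewrite ltn_eqF.
have pNr : ~~ (p %| r)%N by rewrite dvdn_prime2 // ltn_eqF // (ltn_trans lt_pq).
have [c lt_cp cq1] : exists2 c, (c < p)%N & (c * q = 1 %[mod p])%N.
  by apply: mod_inverse; rewrite // prime_coprime // dvdn_prime2.
have J_inj := mod_quot_progression_inj (n := n) p_pr pNr cq1.
have r_gt0 := prime_gt0 r_pr; have c_gt0 := mod_inv_gt0 cq1 p_pr.
have lt_p1 s : (s < p - 1)%N -> (s < p)%N by lia.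
have JK := mod_quotK cq1.
have le_deg : ((p - 2) * r <= (p - 1) * (q - 1))%N.
  have lt_s : (p - 2 < p - 1)%N by lia.
  have nz_Phi : ('Phi_(p * q))`_(n + (p - 2) * r) != 0.
    by rewrite Phi_e // -normr_eq0 norm_e.
  rewrite leqNgt; apply/negP => lt_deg; move: nz_Phi; rewrite nth_default ?eqxx //.
  rewrite size_Cyclotomic totient_coprime ?prime_coprime ?dvdn_prime2 //.
  by rewrite !totient_prime // -!subn1; lia.
have lt_deg : ((p - 2) * r < (p - 1) * (q - 1))%N.
  (* Equality would make the prime [r] divide [p - 1] or [q - 1]. *)
  rewrite ltn_neqAle le_deg andbT; apply/eqP => eq_deg.
  have : (r %| (p - 1) * (q - 1))%N by rewrite -eq_deg dvdn_mull.
  by rewrite Euclid_dvdM // !gtnNdvd //; lia.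
split=> //; have [e1 | eN1] : e = 1 \/ e = -1 by lia.
  rewrite {}e1 in Phi_e.
  have [s lt_s|s t lt_s lt_t|def_c K0 K1] := @progression_blocks p q r n c
    (fun s => mod_quot p c (n + s * r)) p_gt2 r_gt0 lt_cp.
  - by apply: coef_Cyclotomic_prime2_eq1 => //; apply: Phi_e.
  - by apply: J_inj; apply: lt_p1.
  (* The values [J n = 0] and [J (n + r) = 1] give n = 0 and r = q modulo [p], while [c = p - 1]
     gives q = -1. *)
  have := JK (n + 1 * r)%N; have := JK (n + 0 * r)%N.
  rewrite K0 K1 mul0n mul1n mod0n addn0 => n0; rewrite -modnDml -n0 add0n mul1n => eq_qr.
  have p_q1 : (p %| q + 1)%N.
    by rewrite /dvdn -modnDmr -cq1 modnDmr -mulSn def_c subn1 (prednK (prime_gt0 p_pr)) modnMr.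
  by right; split=> //; rewrite /dvdn -modnDml -eq_qr modnDml.
rewrite {}eN1 in Phi_e.
have J_ge s : (s < p - 1)%N ->
    [/\ (c <= mod_quot p c (n + s * r))%N, (mod_quot p c (n + s * r) < p)%N
      & ((mod_quot p c (n + s * r) - c) * q < n + s * r < mod_quot p c (n + s * r) * q)%N].
  by move=> lt_s; apply: coef_Cyclotomic_prime2_eqN1 => //; apply: Phi_e.
have [|s lt_s|s t lt_s lt_t|def_c K0 K1] := @progression_blocks p q r n (p - c)
    (fun s => mod_quot p c (n + s * r) - c)%N p_gt2 r_gt0.
- by lia.
- have [le_c lt_J /andP[/ltnW lo /ltnW hi]] := J_ge s lt_s; split; first by lia.
  by rewrite (subKn (ltnW lt_cp)) (subnK le_c) lo.
- have [le_cs _ _] := J_ge s lt_s; have [le_ct _ _] := J_ge t lt_t => eqK.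
  by apply: J_inj; [exact: lt_p1 | exact: lt_p1 | lia].
have c1 : c = 1%N by lia.
have [|le0 _ _] := J_ge 0%N; first by lia.
have [|le1 _ _] := J_ge 1%N; first by lia.
have J0 : mod_quot p c (n + 0 * r) = 1%N by lia.
have J1 : mod_quot p c (n + 1 * r) = 2%N by lia.
(* Modulo [p], n = q and n + r = 2q, so r = q = 1. *)
have := JK (n + 1 * r)%N; have := JK (n + 0 * r)%N.
rewrite J0 J1 !mul1n mul0n addn0 => eq_qn eq_2q; move: cq1; rewrite c1 mul1n => q1.
left; split=> //; rewrite -q1; apply/eqP.
by rewrite -(eqn_modDl n) -eq_2q mul2n -addnn -modnDml eq_qn modnDml.
Qed.

(** As [q - 1 < r], passing from [p - 2] down to [s] in the degree bound lowers the left side at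
    least as much as the right, so s r < (s + 1)(q - 1). *)
Lemma progression_lt_block (p q r s : nat) : (q < r)%N ->
    ((p - 2) * r < (p - 1) * (q - 1))%N -> (s < p - 1)%N ->
  (1 + s * r < s.+1 * q)%N.
Proof.
move=> lt_qr lt_deg lt_s.
have [t def_p] : exists t, p = (s + t).+2 by exists (p - 2 - s)%N; lia.
case: q lt_qr lt_deg => [|u] lt_ur; first by rewrite sub0n muln0.
have le_t : (t * u <= t * r)%N by rewrite leq_mul2l; lia.
by rewrite def_p !subSS !subn0; lia.
Qed.

Lemma extremal_progression (p q r : nat) :
    prime p -> prime q -> (p < q)%N -> (q < r)%N -> extremal_nat p q r ->
  exists n e, [/\ (n < r)%N, `|e| = 1 &
    forall s, (s < p - 1)%N -> ('Phi_(p * q))`_(n + s * r) = e].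
Proof.
move=> p_pr q_pr lt_pq lt_qr [q_r lt_deg].
have p_gt1 := prime_gt1 p_pr; have neq_pq : p != q by rewrite ltn_eqF.
have lt_p t : (t < p - 1)%N -> (t.+1 < p)%N by rewrite ltn_subRL.
have r_gt1 : (1 < r)%N by apply: leq_ltn_trans lt_qr; apply: prime_gt0.
have lt_block s := @progression_lt_block p q r s lt_qr lt_deg.
case: q_r => [[q1 r1] | [qN1 rN1]].
  have cq1 : (1 * q = 1 %[mod p])%N by rewrite mul1n.
  (* [J] is [s.+1] at [1 + s * r] and [s] at [s * r]; the first inequality fails by [lt_block], the
     second holds by [q < r]. *)
  exists 1%N, (-1); split=> [||s lt_s]; rewrite ?normrN ?normr1 ?(ltnW r_gt1) //.
  have Js : mod_quot p 1 (1 + s * r) = s.+1.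
    apply: (mod_quot_uniq cq1); first by rewrite ?(ltnW (lt_p _ lt_s)) ?lt_p.
    by rewrite -modnMmr q1 modnMmr muln1 -modnDmr -modnMmr r1 modnMmr modnDmr muln1.
  have Js1 : mod_quot p 1 (s * r) = s.
    apply: (mod_quot_uniq cq1); first by rewrite ?(ltnW (lt_p _ lt_s)) ?lt_p.
    by rewrite -modnMmr q1 -r1 modnMmr.
  rewrite (coef_Cyclotomic_prime2 cq1) // Js add1n /= Js1 (leq_mul2l s) (ltnW lt_qr) orbT.
  by have := lt_block s lt_s; rewrite add1n ltnNge => /negPf->.
have cq1 : ((p - 1) * q = 1 %[mod p])%N.
  apply/eqP; rewrite -(eqn_modDr (q + 1)) addnA -mulSnr subn1 prednK ?prime_gt0 //.
  by rewrite mulnC modnMDl -[X in _ == X]modnDmr (eqP qN1) addn0.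
(* [J] is [s] at [s * r] and [s.+1] at its predecessor, so the two inequalities exchange their
   roles; at [s = 0] there is no predecessor. *)
exists 0%N, 1; split=> [||s lt_s]; rewrite ?normr1 ?(ltnW r_gt1) //.
have Js : mod_quot p (p - 1) (0 + s * r) = s.
  apply: (mod_quot_uniq cq1); first by rewrite ?(ltnW (lt_p _ lt_s)) ?lt_p.
  apply/eqP; rewrite add0n -(eqn_modDr s) -mulnSr -mulnSr -[q.+1]addn1 -[r.+1]addn1.
  by have /eqP-> := dvdn_mull s qN1; have /eqP-> := dvdn_mull s rN1.
rewrite (coef_Cyclotomic_prime2 cq1) // Js (leq_mul2l s) (ltnW lt_qr) orbT.
case: (posnP (0 + s * r)) => [-> // | sr_gt0].
have Js1 : mod_quot p (p - 1) (0 + s * r).-1 = s.+1.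
  apply: (mod_quot_uniq cq1); first by rewrite ?(ltnW (lt_p _ lt_s)) ?lt_p.
  apply/eqP; rewrite -(eqn_modDr s.+1) -mulnSr addnS -addSn prednK // -mulnSr.
  rewrite -[q.+1]addn1 -[r.+1]addn1.
  by have /eqP-> := dvdn_mull s.+1 qN1; have /eqP-> := dvdn_mull s rN1.
have lt_sr : (0 + s * r < s.+1 * q)%N := ltnW (lt_block s lt_s).
by rewrite Js1 leqNgt prednK // (ltnW lt_sr).
Qed.

(** * The height of ['Psi_(p * q * r)] *)

Lemma height_attained (f : {poly int}) : exists k, height f = `|(f`_k)%R|%N.
Proof.
have [f0 | f_gt0] := posnP (size f).
  by exists 0%N; rewrite /height f0 big_ord0 nth_default ?f0.
have [|i max_i] := @bigop.eq_bigmax _ (fun i : 'I_(size f) => `|(f`_i)%R|%N).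
  by rewrite card_ord.
by exists i; exact: max_i.
Qed.

(** At least one zero, at position [p], separates the block of -1 from the block of 1. *)
Lemma sign_poly_eq (p q i : nat) : (p < q)%N ->
  (sign_poly p q)`_i != 0 -> (sign_poly p q)`_i.+1 != 0 ->
  (sign_poly p q)`_i = (sign_poly p q)`_i.+1.
Proof.
move=> lt_pq; rewrite !coef_sign_poly.
case: (leqP q i); case: (ltnP i p); case: (leqP q i.+1); case: (ltnP i.+1 p);
  case: (ltnP i (q + p)); case: (ltnP i.+1 (q + p)) => //=; lia.
Qed.

Lemma norm_coef_sign_poly (p q i : nat) : `|(sign_poly p q)`_i| <= 1.
Proof. by rewrite coef_sign_poly; case: (_ && _); case: (_ < _)%N. Qed.

Section Height.

Variables p q r : nat.
Hypotheses (p_pr : prime p) (q_pr : prime q) (r_pr : prime r).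
Hypotheses (p_gt2 : (2 < p)%N) (lt_pq : (p < q)%N) (lt_qr : (q < r)%N).

(** The weight of the coefficient of ['Phi_(p * q)] at [t + s * r] in that of ['Psi_(p * q * r)] at
    [t + n * r], for [t < r]. *)
Definition window_sign (n s : nat) : int :=
  if (s <= n)%N then (sign_poly p q)`_(n - s) else 0.

Lemma coef_InvCyclotomic_prime3 (k : nat) : ('Psi_(p * q * r))`_k =
  \sum_(s < p - 1) window_sign (k %/ r) s * ('Phi_(p * q))`_(k %% r + s * r).
Proof.
have neq_pq : p != q by rewrite ltn_eqF.
have neq_pr : p != r by rewrite ltn_eqF // (ltn_trans lt_pq).
have neq_qr : q != r by rewrite ltn_eqF.
rewrite {1}(divn_eq k r) addnC InvCyclotomic_prime3_comp //.
apply: coef_mul_comp_Xn_trunc; first by rewrite ltn_mod prime_gt0.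
rewrite size_Cyclotomic totient_coprime ?prime_coprime ?dvdn_prime2 //.
by rewrite !totient_prime // subn1 ltn_pmul2l; lia.
Qed.

Lemma norm_term_le1 (n s m : nat) : `|window_sign n s * ('Phi_(p * q))`_m| <= 1.
Proof.
have neq_pq : p != q by rewrite ltn_eqF.
have [c lt_cp cq1] : exists2 c, (c < p)%N & (c * q = 1 %[mod p])%N.
  by apply: mod_inverse; rewrite // prime_coprime // dvdn_prime2.
rewrite normrM mulr_ile1 ?(norm_coef_Cyclotomic_prime2 cq1) //.
by rewrite /window_sign; case: ifP => // _; apply: norm_coef_sign_poly.
Qed.

Lemma height_InvCyclotomic_le : (height 'Psi_(p * q * r) <= p - 1)%N.
Proof.
apply/height_leP => k; rewrite -lez_nat abszE coef_InvCyclotomic_prime3.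
apply: le_trans (ler_norm_sum _ _ _) _.
apply: (@le_trans _ _ (\sum_(s < p - 1) 1)).
  by apply: ler_sum => s _; apply: norm_term_le1.
by rewrite sumr_const card_ord natz.
Qed.

Lemma height_InvCyclotomic_eq :
  height 'Psi_(p * q * r) = (p - 1)%N <-> extremal_nat p q r.
Proof.
split=> [|extr].
  have [k ->] := height_attained 'Psi_(p * q * r) => norm_k.
  have : `|('Psi_(p * q * r))`_k| = (p - 1)%N%:Z by rewrite -abszE norm_k.
  rewrite coef_InvCyclotomic_prime3 => /sum_norm_le1_extremal[s|e norm_e all_e].
    exact: norm_term_le1.
  set n := (k %/ r)%N in all_e; set t := (k %% r)%N in all_e.
  have term_e s : (s < p - 1)%N -> window_sign n s * ('Phi_(p * q))`_(t + s * r) = e.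
    by move=> lt_s; apply: (all_e (Ordinal lt_s)).
  have sign_neq0 s : (s < p - 1)%N -> window_sign n s != 0.
    move=> lt_s; apply/eqP => v0; move: norm_e.
    by rewrite -(term_e s lt_s) v0 mul0r normr0.
  (* All weights are nonzero and sit at adjacent positions of [sign_poly], so they lie in a single
     block. *)
  have sign_const s : (s < p - 1)%N -> window_sign n s = window_sign n 0%N.
    elim: s => // s IH lt_s; rewrite -(IH (ltnW lt_s)).
    have := sign_neq0 _ lt_s; have := sign_neq0 _ (ltnW lt_s); rewrite /window_sign.
    case: ltnP => [lt_sn | _]; last by rewrite eqxx.
    by rewrite (ltnW lt_sn) -(subnSK lt_sn) => nz nz'; apply: sign_poly_eq.
  have norm_sign : `|window_sign n 0%N| = 1.
    have p1_gt0 : (0 < p - 1)%N by rewrite subn_gt0 prime_gt1.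
    have := sign_neq0 _ p1_gt0; rewrite -normr_gt0 gtz0_ge1 /window_sign /=.
    by move=> ge1; apply/eqP; rewrite eq_le ge1 norm_coef_sign_poly.
  apply: (@coef_Cyclotomic_prime2_progression p q r t (e * window_sign n 0%N)) => //.
    by rewrite normrM norm_e norm_sign.
  move=> s lt_s; rewrite -(term_e s lt_s) sign_const // mulrAC -expr2.
  by rewrite -real_normK ?num_real // norm_sign expr1n mul1r.
have [n [e [lt_nr norm_e Phi_e]]] := extremal_progression p_pr q_pr lt_pq lt_qr extr.
apply/eqP; rewrite eqn_leq height_InvCyclotomic_le /=.
(* At this index the positions [p - 2 - s] stay in the block of -1, so every term equals [- e]. *)
have /height_leP/(_ (n + (p - 2) * r)%N) := leqnn (height 'Psi_(p * q * r)).
apply: leq_trans; rewrite -lez_nat abszE coef_InvCyclotomic_prime3.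
rewrite addnC modnMDl divnMDl ?prime_gt0 // modn_small // divn_small // addn0.
have -> : \sum_(s < p - 1) window_sign (p - 2) s * ('Phi_(p * q))`_(n + s * r) =
    \sum_(s < p - 1) - e.
  apply: eq_bigr => s _; rewrite Phi_e // /window_sign.
  have -> : (s <= p - 2)%N by rewrite -ltnS -subSn ?prime_gt1 // subSS.
  have lt_ip : (p - 2 - s < p)%N by rewrite -subnDA ltn_subrL (prime_gt0 p_pr).
  by rewrite coef_sign_poly [(q <= _)%N]leqNgt (ltn_trans lt_ip lt_pq) lt_ip /= sub0r mulN1r.
by rewrite sumr_const card_ord normrMn normrN norm_e natz.
Qed.

End Height.

(** * Passage to integer congruences and the rational bound *)

Lemma eqz_modN1 (p n : nat) : (n%:Z = -1 %[mod p%:Z])%Z <-> (p %| n + 1)%N.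
Proof.
have -> : (p %| n + 1)%N = (n%:Z == -1 %[mod p%:Z])%Z.
  by rewrite eqz_mod_dvd opprK /dvdz.
by split=> /eqP.
Qed.

Lemma eqz_mod1 (p n : nat) : (n%:Z = 1 %[mod p%:Z])%Z <-> (n = 1 %[mod p])%N.
Proof. by rewrite !modz_nat; split=> [[] | ->]. Qed.

Lemma ltr_ratio_nat (p q r : nat) : (2 < p)%N -> (0 < q)%N ->
  (r%:R < (p%:R - 1) / (p%:R - 2) * (q%:R - 1) :> rat) =
  ((p - 2) * r < (p - 1) * (q - 1))%N.
Proof.
move=> p_gt2 q_gt0; have p2_gt0 : 0 < (p - 2)%N%:R :> rat by rewrite ltr0n subn_gt0.
have subr1 n : (0 < n)%N -> n%:R - 1 = (n - 1)%N%:R :> rat by move=> ?; rewrite natrB.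
rewrite !subr1 ?(ltnW (ltnW p_gt2)) // -natrB ?(ltnW p_gt2) // mulrAC ltr_pdivlMr //.
by rewrite -!natrM ltr_nat mulnC.
Qed.

Theorem theorem2 (p q r : nat)
    (p_prime : prime p) (q_prime : prime q) (r_prime : prime r)
    (p_odd : odd p) (q_odd : odd q) (r_odd : odd r)
    (lt_pq : (p < q)%N) (lt_qr : (q < r)%N) :
  let extremal : Prop :=
    (((q%:Z = 1 %[mod p%:Z])%Z /\ (r%:Z = 1 %[mod p%:Z])%Z) \/
     ((q%:Z = -1 %[mod p%:Z])%Z /\ (r%:Z = -1 %[mod p%:Z])%Z)) /\
    (r%:R < (p%:R - 1) / (p%:R - 2) * (q%:R - 1) :> rat) in
  (height 'Psi_(p * q * r) = (p - 1)%N <-> extremal) /\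
  (~ extremal -> (height 'Psi_(p * q * r) < p - 1)%N).
Proof.
move=> extremal; have p_gt2 := odd_prime_gt2 p_odd p_prime.
have extrE : extremal <-> extremal_nat p q r.
  by rewrite /extremal ltr_ratio_nat ?prime_gt0 // !eqz_mod1 !eqz_modN1.
have eqP1 := height_InvCyclotomic_eq p_prime q_prime r_prime p_gt2 lt_pq lt_qr.
split=> [|not_extr]; first by rewrite extrE.
rewrite ltn_neqAle height_InvCyclotomic_le // andbT.
by apply/eqP => /eqP1/extrE.
Qed.
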